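(* For every nonnegative integer $n$, $$\overline{A}_{125}(25n)\equiv \overline{A}_{125}(625n) \pmod{5}.$$
   Context: An overpartition of $n$ is a partition of $n$ in which the first occurrence of each distinct part may be overlined. For a positive integer $\ell$, $\overline{A}_\ell(n)$ denotes the number of overpartitions of $n$ into parts not divisible by $\ell$, with $\overline{A}_\ell(0)=1$; equivalently $$\sum_{n\ge 0}\overline{A}_\ell(n)q^n=\frac{(q^\ell;q^\ell)_\infty^2(q^2;q^2)_\infty}{(q;q)_\infty^2(q^{2\ell};q^{2\ell})_\infty},\qquad (a;q)_\infty=\prod_{k\ge 0}(1-aq^k).$$ *)

(* Defs.v *)
From mathcomp Require Import all_boot.

Set Implicit Arguments.
Unset Strict Implicit.
Unset Printing Implicit Defensive.

(* An overpartition is the list, in nonincreasing order, of its parts, each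
   paired with a boolean that is true when the part is overlined. The last
   clause says that an overlined part differs from every part listed before it,
   i.e., that it is the first occurrence of its value. *)
Definition overpartition (n : nat) (s : seq (nat * bool)) : bool :=
  [&& all (fun x => 0 < x.1) s,
      \sum_(x <- s) x.1 == n,
      pairwise (fun x y => y.1 <= x.1) s
    & pairwise (fun x y => y.2 ==> (y.1 != x.1)) s].

(* An overpartition of n has at most n parts, all of them at most n, so the
   finite type of sequences of length at most n over 'I_n.+1 * bool contains
   all of them. *)
Definition parts_of (n : nat) (t : n.-bseq ('I_n.+1 * bool)) :
    seq (nat * bool) :=
  [seq (val x.1, x.2) | x <- t].

Lemma parts_of_inj (n : nat) : injective (@parts_of n).
Proof.
move=> t u /inj_map tu; apply/val_inj/tu.
by move=> [i a] [j b] /= [/val_inj-> ->].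
Qed.

Lemma overpartition_parts_of (n : nat) (s : seq (nat * bool)) :
  overpartition n s -> exists t : n.-bseq ('I_n.+1 * bool), parts_of t = s.
Proof.
case/and4P=> s_gt0 /eqP sn _ _.
have le_n x : x \in s -> x.1 < n.+1.
  by move=> xs; rewrite ltnS -sn (big_rem x xs) leq_addr.
have sz : size [seq (inord x.1 : 'I_n.+1, x.2) | x <- s] <= n.
  rewrite size_map -sn -sum1_size big_seq [leqRHS]big_seq.
  by apply: leq_sum => x /(allP s_gt0).
exists (Bseq sz); rewrite /parts_of /= -map_comp -[RHS]map_id.
by apply/eq_in_map => -[k b] /le_n /= kn; rewrite inordK.
Qed.

Definition overlineA (l n : nat) : nat :=
  #|[set t : n.-bseq ('I_n.+1 * bool)
      | overpartition n (parts_of t)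
        & all (fun x => ~~ (l %| x.1)) (parts_of t)]|.

(* Main.v *)
From HB Require Import structures.
From mathcomp Require Import all_boot all_order all_algebra.
From mathcomp Require Import finfield boolp.
From mathcomp Require Import ring zify.
Require Import Defs.

(** Let th = sum_j (-1)^j q^(j^2). By Gauss' identity the generating function of
    the overpartitions into parts not divisible by 125 is th(q^125) / th(q), which
    is th^124 modulo 5. Write U_m for the extraction of the coefficients of the
    q^(m n), and T for q d/dq. Since U_5 (f g^5) = U_5(f) g modulo 5, everything
    follows from two congruences for sums of squares,
      r_4(5 n) = r_4(n)   and   r_3(25 n) = (1 - n^2) r_3(n)   modulo 5,
    which count integral quaternions divisible by one of the six quaternions of
    norm 5 (up to units). The first says U_5(th^4) = th^4, so that
    U_25(A) = th^5 U_5(th^3) and U_625(A) = U_5(th U_25(th^3)); the second says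
    U_25(th^3) = th^3 - T^2(th^3). As U_5 T = 0, integration by parts gives
    U_5(th T^2(th^3)) = U_5(th^3 T^2(th)), and T^2(th) = th - th^25 by Fermat's
    little theorem; hence U_625(A) = th^5 U_5(th^3). *)

Set Implicit Arguments.
Unset Strict Implicit.
Unset Printing Implicit Defensive.

Import GRing.Theory Num.Theory.
Local Open Scope ring_scope.

(** * Formal power series *)

Record fps (R : Type) := Fps { cf : nat -> R }.

HB.instance Definition _ (R : Type) := gen_eqMixin (fps R).
HB.instance Definition _ (R : Type) := gen_choiceMixin (fps R).

Lemma fpsP (R : Type) (f g : fps R) : (forall n, cf f n = cf g n) -> f = g.
Proof. by case: f g => [f] [g] /= fg; congr Fps; apply/funext. Qed.

Section FpsRing.
Variable R : comNzRingType.
Implicit Types (f g h : fps R) (n N : nat).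

Definition fps0 : fps R := Fps (fun=> 0).
Definition fps_opp f := Fps (fun n => - cf f n).
Definition fps_add f g := Fps (fun n => cf f n + cf g n).
Definition fps1 : fps R := Fps (fun n => (n == 0%N)%:R).
Definition fps_mul f g := Fps (fun n => \sum_(i < n.+1) cf f i * cf g (n - i)).

Lemma fps_addA : associative fps_add.
Proof. by move=> f g h; apply: fpsP => n; apply: addrA. Qed.
Lemma fps_addC : commutative fps_add.
Proof. by move=> f g; apply: fpsP => n; apply: addrC. Qed.
Lemma fps_add0 : left_id fps0 fps_add.
Proof. by move=> f; apply: fpsP => n; apply: add0r. Qed.
Lemma fps_addN : left_inverse fps0 fps_opp fps_add.
Proof. by move=> f; apply: fpsP => n; apply: addNr. Qed.

HB.instance Definition _ :=
  GRing.isZmodule.Build (fps R) fps_addA fps_addC fps_add0 fps_addN.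

(** Coefficient n of a product involves only coefficients up to n, so commutativity and
    associativity can be borrowed from polynomials. *)
Definition fps_trunc N f : {poly R} := \poly_(i < N) cf f i.

Lemma coef_fps_trunc_mul N f g n : (n < N)%N ->
  cf (fps_mul f g) n = (fps_trunc N f * fps_trunc N g)`_n.
Proof.
move=> nN; rewrite coefM; apply: eq_bigr => i _.
rewrite !coef_poly !ifT //; first exact: leq_ltn_trans (leq_subr _ _) nN.
exact: leq_ltn_trans (leq_ord i) nN.
Qed.

Lemma fps_mulC : commutative fps_mul.
Proof.
by move=> f g; apply: fpsP => n; rewrite !(@coef_fps_trunc_mul n.+1) // mulrC.
Qed.

Lemma fps_mulA : associative fps_mul.
Proof.
have aux f g h n : cf (fps_mul f (fps_mul g h)) n =
    (fps_trunc n.+1 f * (fps_trunc n.+1 g * fps_trunc n.+1 h))`_n.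
  rewrite coefM; apply: eq_bigr => i _.
  by rewrite (@coef_fps_trunc_mul n.+1) ?ltnS ?leq_subr // coef_poly ltn_ord.
move=> f g h; apply: fpsP => n.
by rewrite aux [fps_mul (fps_mul f g) h]fps_mulC aux mulrA mulrC.
Qed.

Lemma fps_mul1 : left_id fps1 fps_mul.
Proof.
move=> f; apply: fpsP => n; rewrite /= big_ord_recl /= mul1r subn0 big1 ?addr0 //.
by move=> i _; rewrite mul0r.
Qed.

Lemma fps_mulD : left_distributive fps_mul fps_add.
Proof.
move=> f g h; apply: fpsP => n; rewrite /= -big_split.
by apply: eq_bigr => i _; rewrite mulrDl.
Qed.

Lemma fps1_neq0 : fps1 != 0.
Proof.
by apply/eqP => /(congr1 (fun f => cf f 0)) /eqP; rewrite /= oner_eq0.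
Qed.

HB.instance Definition _ := GRing.Zmodule_isComNzRing.Build (fps R)
  fps_mulA fps_mulC fps_mul1 fps_mulD fps1_neq0.

Lemma cfD f g n : cf (f + g) n = cf f n + cf g n. Proof. by []. Qed.
Lemma cfN f n : cf (- f) n = - cf f n. Proof. by []. Qed.
Lemma cfB f g n : cf (f - g) n = cf f n - cf g n. Proof. by []. Qed.
Lemma cf0 n : cf (0 : fps R) n = 0. Proof. by []. Qed.
Lemma cf1 n : cf (1 : fps R) n = (n == 0%N)%:R. Proof. by []. Qed.
Lemma cfM f g n : cf (f * g) n = \sum_(i < n.+1) cf f i * cf g (n - i).
Proof. by []. Qed.

Lemma cf_sum (I : Type) (r : seq I) (P : pred I) (F : I -> fps R) n :
  cf (\sum_(i <- r | P i) F i) n = \sum_(i <- r | P i) cf (F i) n.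
Proof. exact: (big_morph (fun f => cf f n) (fun f g => cfD f g n) (cf0 n)). Qed.

Definition fpsX : fps R := Fps (fun n => (n == 1%N)%:R).

Lemma cfXM f n : cf (fpsX * f) n = if n is n'.+1 then cf f n' else 0.
Proof.
rewrite cfM; case: n => [|n]; first by rewrite big_ord1 mul0r.
rewrite big_ord_recl mul0r add0r big_ord_recl /= mul1r subSS subn0.
by rewrite big1 ?addr0 // => i _; rewrite mul0r.
Qed.

Lemma cfXnM m f n : cf (fpsX ^+ m * f) n = if (m <= n)%N then cf f (n - m) else 0.
Proof.
elim: m n => [|m IH] n; first by rewrite mul1r subn0.
by rewrite exprS -mulrA cfXM; case: n.
Qed.

Lemma cfXn m n : cf (fpsX ^+ m) n = (n == m)%:R.
Proof.
by rewrite -[fpsX ^+ m]mulr1 cfXnM cf1 subn_eq0 [n == m]eqn_leq andbC; case: leqP.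
Qed.

Lemma cf_sign k f n : cf ((-1) ^+ k * f) n = (-1) ^+ k * cf f n.
Proof.
elim: k => [|k IH]; first by rewrite !expr0 !mul1r.
by rewrite !exprS -!mulrA !mulN1r cfN IH.
Qed.

(** Congruence modulo q^N, which lets finite products stand in for infinite ones. *)
Definition fps_eqm N f g := forall n, (n < N)%N -> cf f n = cf g n.

Lemma fps_eqm_trans N f g h : fps_eqm N f g -> fps_eqm N g h -> fps_eqm N f h.
Proof. by move=> fg gh n nN; rewrite fg ?gh. Qed.

Lemma fps_eqm_sym N f g : fps_eqm N f g -> fps_eqm N g f.
Proof. by move=> fg n nN; rewrite fg. Qed.

Lemma fps_eqm_mul N f f' g g' :
  fps_eqm N f f' -> fps_eqm N g g' -> fps_eqm N (f * g) (f' * g').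
Proof.
move=> ff gg n nN; rewrite !cfM; apply: eq_bigr => i _.
rewrite ff ?gg //; last exact: leq_ltn_trans (leq_ord i) nN.
exact: leq_ltn_trans (leq_subr _ _) nN.
Qed.

Lemma fps_eqm_exp N f f' k : fps_eqm N f f' -> fps_eqm N (f ^+ k) (f' ^+ k).
Proof.
by move=> ff; elim: k => [|k IH] //; rewrite !exprS; apply: fps_eqm_mul.
Qed.

Lemma fps_eqm_DXn N f g m : (N <= m)%N -> fps_eqm N (f + fpsX ^+ m * g) f.
Proof.
by move=> Nm n nN; rewrite cfD cfXnM leqNgt (leq_trans nN Nm) addr0.
Qed.

Lemma cf0M f g : cf (f * g) 0 = cf f 0 * cf g 0.
Proof. by rewrite cfM big_ord1. Qed.

(** Coefficient n of [u * f] is that of [f] plus terms in earlier coefficients of [f], on which the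
    induction applies. *)
Lemma fps_eqm_cancel N u f g : cf u 0 = 1 ->
  fps_eqm N (u * f) (u * g) -> fps_eqm N f g.
Proof.
move=> u0 ufg n; elim/ltn_ind: n => n IH nN.
have := ufg n nN; rewrite !cfM !big_ord_recl !u0 !mul1r !subn0.
rewrite [X in _ + X = _](eq_bigr (fun i : 'I_n => cf u (lift ord0 i) * cf g (n - lift ord0 i))).
  exact: addIr.
by move=> i _; rewrite lift0 IH //; have := ltn_ord i; lia.
Qed.

Lemma fps_cancel u f g : cf u 0 = 1 -> u * f = u * g -> f = g.
Proof.
move=> u0 ufg; apply: fpsP => n.
by apply: (@fps_eqm_cancel n.+1 u) => // i _; rewrite ufg.
Qed.

End FpsRing.

Arguments fpsX {R}.

(** * The operators U_m and T = q d/dq *)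

Section Operators.
Variable R : comNzRingType.
Implicit Types f g : fps R.

Definition fps_dissect m f := Fps (fun n => cf f (m * n)%N).
Definition fps_euler f := Fps (fun n => n%:R * cf f n).

Lemma cf_dissect m f n : cf (fps_dissect m f) n = cf f (m * n).
Proof. by []. Qed.

Lemma cf_euler f n : cf (fps_euler f) n = n%:R * cf f n. Proof. by []. Qed.

Lemma fps_dissectB m f g :
  fps_dissect m (f - g) = fps_dissect m f - fps_dissect m g.
Proof. exact: fpsP. Qed.

Lemma fps_dissect_comp m k f :
  fps_dissect k (fps_dissect m f) = fps_dissect (m * k) f.
Proof. by apply: fpsP => n /=; rewrite mulnA. Qed.

Lemma fps_eulerM f g : fps_euler (f * g) = fps_euler f * g + f * fps_euler g.
Proof.
apply: fpsP => n; rewrite cf_euler cfD !cfM mulr_sumr -big_split; apply: eq_bigr => i _.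
rewrite /= -{1}(subnKC (leq_ord i)) natrD; ring.
Qed.

End Operators.

(** * Frobenius and extraction over the field with p elements *)

Section CharP.
Variable p : nat.
Hypothesis p_pr : prime p.
Implicit Types f g : fps 'F_p.

Lemma pchar_fps : p \in [pchar (fps 'F_p)].
Proof.
apply/andP; split=> //; apply/eqP/fpsP => n.
have E k : cf (k%:R : fps 'F_p) n = (k * (n == 0))%N%:R.
  by elim: k => [|k IH] //; rewrite -natr1 cfD IH cf1 mulSn natrD addrC.
by rewrite E natrM pchar_Fp_0 ?mul0r.
Qed.

Definition fpsC (c : 'F_p) : fps 'F_p := Fps (fun n => c * (n == 0%N)%:R).

Lemma cfCM c f n : cf (fpsC c * f) n = c * cf f n.
Proof.
rewrite cfM big_ord_recl /= mulr1 subn0 big1 ?addr0 // => i _.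
by rewrite mulr0 mul0r.
Qed.

Lemma fpsC_exp c k : fpsC c ^+ k = fpsC (c ^+ k).
Proof.
elim: k => [|k IH]; first by apply: fpsP => n; rewrite expr0 cf1 /= expr0 mul1r.
by rewrite exprS IH; apply: fpsP => n; rewrite cfCM exprS /= mulrA.
Qed.

Lemma Fp_fermat (c : 'F_p) : c ^+ p = c.
Proof.
by have := expf_card c; rewrite card_Fp.
Qed.

(** This is f(q)^p = f(q^p): the Frobenius map is additive and fixes the constants. *)
Lemma cf_frobenius f n :
  cf (f ^+ p) n = if (p %| n)%N then cf f (n %/ p) else 0.
Proof.
(* Coefficient n depends only on this finite truncation, to which additivity applies. *)
pose g := \sum_(i < n.+1) fpsC (cf f i) * fpsX ^+ i.
have fg : fps_eqm n.+1 f g.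
  move=> k kn; rewrite cf_sum (bigD1 (Ordinal kn)) // cfCM cfXn eqxx mulr1.
  rewrite big1 => [|i]; first by rewrite /= addr0.
  rewrite cfCM cfXn -val_eqE eq_sym => /negPf /= ->.
  by rewrite mulr0.
rewrite (fps_eqm_exp p fg) // -(pFrobenius_autE pchar_fps) rmorph_sum /= cf_sum.
under eq_bigr => i _ do
  rewrite pFrobenius_autE exprMn fpsC_exp Fp_fermat -exprM cfCM cfXn.
case: ifPn => [/dvdnP[k ->]|pn].
  rewrite mulnK ?prime_gt0 //.
  have kn : (k < (k * p).+1)%N by rewrite ltnS leq_pmulr ?prime_gt0.
  rewrite (bigD1 (Ordinal kn)) //= eqxx mulr1 big1 ?addr0 // => i.
  by rewrite -val_eqE /= eqn_pmul2r ?prime_gt0 // eq_sym => /negPf->; rewrite mulr0.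
rewrite big1 // => i _; case: eqP => [E|]; last by rewrite mulr0.
by case/negP: pn; apply/dvdnP; exists i.
Qed.

(** As g^p is a series in q^p, only indices divisible by p contribute to coefficient p n of the
    product. *)
Lemma fps_dissect_mulXp f g :
  fps_dissect p (f * g ^+ p) = fps_dissect p f * g.
Proof.
apply: fpsP => n; rewrite [fps_dissect p f * g]mulrC [f * _]mulrC cf_dissect !cfM.
under eq_bigr => i _ do rewrite cf_frobenius.
rewrite (bigID (fun i : 'I__ => (p %| i)%N)) /= [X in _ + X]big1 ?addr0; last first.
  by move=> i /negPf->; rewrite mul0r.
pose h (i : 'I_n.+1) : 'I_(p * n).+1 := inord (p * i).
have hE (i : 'I_n.+1) : h i = (p * i)%N :> nat.
  by rewrite inordK // ltnS leq_mul2l leq_ord orbT.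
rewrite (reindex_onto h (fun i => inord (i %/ p))) /=.
  rewrite (eq_bigl xpredT) => [|i]; last first.
    by rewrite hE dvdn_mulr // mulKn ?prime_gt0 // inord_val eqxx.
  apply: eq_bigr => i _.
  by rewrite hE dvdn_mulr // mulKn ?prime_gt0 // mulnBr.
move=> i pi; apply: ord_inj; rewrite hE inordK; last first.
  by rewrite ltnS leq_divLR // -(mulnC p) leq_ord.
by rewrite mulnC divnK.
Qed.

(** Coefficient p n is multiplied by p n = 0. With the Leibniz rule this gives integration by parts
    under U_p. *)
Lemma fps_dissect_euler f : fps_dissect p (fps_euler f) = 0.
Proof.
by apply: fpsP => n /=; rewrite natrM pchar_Fp_0 // !mul0r.
Qed.

End CharP.

(** * Gauss' identity *)

Section Gauss.
Variables (R : comNzRingType) (q : R).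

Definition theta_sum n : R := 1 + 2 * \sum_(1 <= j < n.+1) (-1) ^+ j * q ^+ (j ^ 2).
Definition prod_minus m n : R := \prod_(m <= i < n) (1 - q ^+ i).
Definition prod_plus n : R := \prod_(1 <= i < n) (1 + q ^+ i).

Lemma theta_sumS n :
  theta_sum n.+1 = theta_sum n + 2 * (-1) ^+ n.+1 * q ^+ (n.+1 ^ 2).
Proof. by rewrite /theta_sum big_nat_recr //= mulrDr addrA mulrA. Qed.

Let tail n : R := \sum_(1 <= s < n.+1)
  (-1) ^+ s * q ^+ (s * n.+1) * prod_minus s.+1 n.+1 * prod_plus s.

Lemma alternating_sum_telescope (H : nat -> R) n :
  \sum_(1 <= s < n.+1) (-1) ^+ s * (H s + H s.+1) = (-1) ^+ n * H n.+1 - H 1%N.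
Proof.
elim: n => [|n IH]; first by rewrite big_geq // expr0; ring.
by rewrite big_nat_recr //= IH exprS; ring.
Qed.

(* Shanks' finite form of Gauss' identity: the correction [tail n] is divisible
   by q^(n+1). *)
Lemma theta_sum_prod_plus n :
  theta_sum n * prod_plus n.+1 = prod_minus 1 n.+1 + 2 * tail n.
Proof.
elim: n => [|n IH].
  by rewrite /theta_sum /prod_plus /prod_minus /tail !big_geq // mulr0 addr0 mul1r.
have Dn : prod_plus n.+2 = prod_plus n.+1 * (1 + q ^+ n.+1).
  by rewrite /prod_plus big_nat_recr.
have Nn : prod_minus 1 n.+2 = prod_minus 1 n.+1 * (1 - q ^+ n.+1).
  by rewrite /prod_minus big_nat_recr.
(* Chosen so that the sum telescopes: [H n.+1] supplies the new square term of [theta_sum], and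
   [H 1] the change in [prod_minus]. *)
pose H s := q ^+ (s * n.+1) * prod_minus s n.+1 * prod_plus s.
have T : tail n.+1 - (1 + q ^+ n.+1) * tail n =
    (-1) ^+ n.+1 * q ^+ (n.+1 * n.+2) * prod_plus n.+1
    - \sum_(1 <= s < n.+1) (-1) ^+ s * (H s + H s.+1).
  rewrite /tail big_nat_recr //= {2}/prod_minus [X in _ * X * _]big_geq // mulr1.
  rewrite mulr_sumr addrAC addrC; congr (_ + _).
  rewrite -sumrB -sumrN; apply: eq_big_nat => s /andP[s1 sn].
  rewrite /H.
  have -> : prod_minus s.+1 n.+2 = prod_minus s.+1 n.+1 * (1 - q ^+ n.+1).
    by rewrite /prod_minus big_nat_recr.
  have -> : prod_minus s n.+1 = (1 - q ^+ s) * prod_minus s.+1 n.+1.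
    by rewrite /prod_minus big_ltn.
  have -> : prod_plus s.+1 = prod_plus s * (1 + q ^+ s).
    by rewrite /prod_plus big_nat_recr.
  by rewrite [(s * n.+2)%N]mulnS mulSn !exprD; ring.
have Hl : H n.+1 = q ^+ (n.+1 ^ 2) * prod_plus n.+1.
  by rewrite /H /prod_minus big_geq // mulr1 -mulnn.
have H1 : H 1%N = q ^+ n.+1 * prod_minus 1 n.+1.
  by rewrite /H /prod_plus big_geq // mulr1 mul1n.
move/eqP: T; rewrite alternating_sum_telescope Hl H1 subr_eq => /eqP->.
rewrite theta_sumS mulrDl {1}Dn mulrA IH Dn Nn [(n.+1 * n.+2)%N]mulnS mulnn.
by rewrite exprD [(-1) ^+ n.+1]exprS; ring.
Qed.

Lemma theta_sum_approx n :
  exists r, theta_sum n * prod_plus n.+1 = prod_minus 1 n.+1 + q ^+ n.+1 * r.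
Proof.
(* Twice the tail with one factor q^(n+1) taken out of each term, possible because s >= 1. *)
rewrite theta_sum_prod_plus; exists (2 * \sum_(1 <= s < n.+1)
  (-1) ^+ s * q ^+ (s.-1 * n.+1) * prod_minus s.+1 n.+1 * prod_plus s).
congr (_ + _); rewrite /tail !mulr_sumr; apply: eq_big_nat => -[|s] // _.
by rewrite mulSn exprD; ring.
Qed.

End Gauss.

(** * Integral points on spheres *)

(** Zero, positives and negatives are listed apart so that even summands fold into twice a sum over
    j >= 1. As [Negz j] is -(j+1), the last range starts at 0. *)
Definition zbox (N : nat) : seq int :=
  0 :: [seq Posz j | j <- index_iota 1 N.+1] ++ [seq Negz j | j <- iota 0 N].

Lemma mem_zbox N x : (x \in zbox N) = (`|x| <= N)%N.
Proof.
have memP (j : nat) : (Posz j \in [seq Posz j | j <- index_iota 1 N.+1]) = (0 < j <= N)%N.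
  by rewrite mem_map ?mem_index_iota // => a b [].
have memN (j : nat) : (Negz j \in [seq Negz j | j <- iota 0 N]) = (j < N)%N.
  by rewrite mem_map ?mem_iota // => a b [].
rewrite in_cons mem_cat; case: x => j.
  rewrite memP (_ : Posz j \in _ = false) ?orbF; last by apply/negbTE/mapP => -[].
  by case: j.
by rewrite memN (_ : Negz j \in _ = false) //; apply/negbTE/mapP => -[].
Qed.

Lemma zbox_uniq N : uniq (zbox N).
Proof.
rewrite /zbox cons_uniq cat_uniq !map_inj_uniq ?iota_uniq => [|a b []//|a b []//].
rewrite ?iota_uniq ?andbT mem_cat negb_or.
apply/andP; split; last by apply/hasP => -[x] /mapP[j _ ->] /mapP[].
apply/andP; split; apply/mapP => -[j] //.
by rewrite mem_index_iota => /andP[j0 _] [E]; rewrite -E in j0.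
Qed.

Lemma sum_zbox (V : nmodType) (F : nat -> V) N :
  \sum_(x <- zbox N) F `|x|%N = F 0%N + (\sum_(1 <= j < N.+1) F j) *+ 2.
Proof.
rewrite /zbox big_cons big_cat !big_map /= mulr2n; congr (_ + (_ + _)).
by rewrite [index_iota 1 N.+1](iotaDl 1 0) big_map subn1.
Qed.

Definition vec3 := (int * int * int)%type.
Definition vec4 := (int * int * int * int)%type.
Definition norm3 (v : vec3) : nat :=
  let: (a, b, c) := v in (`|a| ^ 2 + `|b| ^ 2 + `|c| ^ 2)%N.
Definition norm4 (v : vec4) : nat :=
  let: (a, b, c, d) := v in (`|a| ^ 2 + `|b| ^ 2 + `|c| ^ 2 + `|d| ^ 2)%N.

Lemma Posz_absz_sqr (x : int) : Posz (`|x| ^ 2)%N = x ^+ 2.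
Proof. by rewrite -mulnn PoszM abszE -expr2 real_normK ?num_real. Qed.

Lemma norm3E (a b c : int) : Posz (norm3 (a, b, c)) = a ^+ 2 + b ^+ 2 + c ^+ 2.
Proof. by rewrite /norm3 !PoszD !Posz_absz_sqr. Qed.

Lemma norm4E (a b c d : int) :
  Posz (norm4 (a, b, c, d)) = a ^+ 2 + b ^+ 2 + c ^+ 2 + d ^+ 2.
Proof. by rewrite /norm4 !PoszD !Posz_absz_sqr. Qed.

Definition zbox3 N : seq vec3 :=
  [seq (x, c) | x <- [seq (a, b) | a <- zbox N, b <- zbox N], c <- zbox N].
Definition zbox4 N : seq vec4 := [seq (x, d) | x <- zbox3 N, d <- zbox N].

(** The box of radius n loses no point, since |x| <= x^2 <= n. *)
Definition sphere3 (n : nat) := [seq v <- zbox3 n | norm3 v == n].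
Definition sphere4 (n : nat) := [seq v <- zbox4 n | norm4 v == n].

Lemma uniq_pairs (S T : eqType) (s : seq S) (t : seq T) :
  uniq s -> uniq t -> uniq [seq (x, y) | x <- s, y <- t].
Proof. by move=> us ut; apply: allpairs_uniq => // -[a b] [c d]. Qed.

Lemma mem_pairs (S T : eqType) (s : seq S) (t : seq T) x y :
  ((x, y) \in [seq (x, y) | x <- s, y <- t]) = (x \in s) && (y \in t).
Proof.
apply/allpairsP/andP => [[[a b]] /= [? ? [-> ->]]//|[? ?]]; by exists (x, y).
Qed.

Lemma leq_self_sqr m : (m <= m ^ 2)%N.
Proof. by rewrite -mulnn; case: m => // m; rewrite leq_pmulr. Qed.

Lemma mem_sphere3 n v : (v \in sphere3 n) = (norm3 v == n).
Proof.
rewrite mem_filter; case: eqP => // <-; case: v => [[a b] c].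
rewrite !mem_pairs !mem_zbox /norm3 -!andbA; apply/and3P; split.
all: have := leq_self_sqr `|a|; have := leq_self_sqr `|b|; have := leq_self_sqr `|c|; lia.
Qed.

Lemma mem_sphere4 n v : (v \in sphere4 n) = (norm4 v == n).
Proof.
rewrite mem_filter; case: eqP => // <-; case: v => [[[a b] c] d].
rewrite !mem_pairs !mem_zbox /norm4 -!andbA; apply/and4P; split.
all: have := leq_self_sqr `|a|; have := leq_self_sqr `|b|; have := leq_self_sqr `|c|.
all: have := leq_self_sqr `|d|; lia.
Qed.

Lemma sphere3_uniq n : uniq (sphere3 n).
Proof. by rewrite filter_uniq // !uniq_pairs ?zbox_uniq. Qed.

Lemma sphere4_uniq n : uniq (sphere4 n).
Proof. by rewrite filter_uniq // !uniq_pairs ?zbox_uniq. Qed.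

(** * Sums of four squares *)

Lemma count_image (S T : eqType) (s : seq S) (t : seq T) (f : T -> S) (P : pred S) :
  uniq s -> uniq t -> injective f ->
  (forall x, x \in s -> P x -> exists2 y, y \in t & f y = x) ->
  (forall y, y \in t -> f y \in s /\ P (f y)) ->
  count P s = size t.
Proof.
move=> us ut f_inj sub1 sub2; rewrite -size_filter -(size_map f).
apply/perm_size/uniq_perm; rewrite ?filter_uniq ?map_inj_uniq // => x.
rewrite mem_filter; apply/andP/mapP => [[Px /sub1[]// y ty <-]|[y /sub2[? ?] ->]] //.
by exists y.
Qed.

(* Left multiplication of the Lipschitz quaternion a + b i + c j + d k by
   1 + e i, 1 + e j, 1 + e k respectively. *)
Definition quat_mul (k : nat) (e : int) (v : vec4) : vec4 :=
  let: (a, b, c, d) := v in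
  match k with
  | 0 => (a - e * b, b + e * a, c - e * d, d + e * c)
  | 1 => (a - e * c, b + e * d, c + e * a, d - e * b)
  | _ => (a - e * d, b - e * c, c + e * b, d + e * a)
  end.

(* Conjugation by 1 + 2 i, 1 + 2 j, 1 + 2 k (for e = 4) or by their conjugates
   (for e = - 4) of the pure quaternion a i + b j + c k. *)
Definition quat_conj (k : nat) (e : int) (v : vec3) : vec3 :=
  let: (a, b, c) := v in
  match k with
  | 0 => (5 * a, - 3 * b - e * c, e * b - 3 * c)
  | 1 => (e * c - 3 * a, 5 * b, - 3 * c - e * a)
  | _ => (- 3 * a - e * b, e * a - 3 * b, 5 * c)
  end.

Definition scale3 (m : int) (v : vec3) : vec3 :=
  let: (a, b, c) := v in (m * a, m * b, m * c).
Definition scale4 (m : int) (v : vec4) : vec4 :=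
  let: (a, b, c, d) := v in (m * a, m * b, m * c, m * d).
Definition dvd3 (m : int) (v : vec3) : bool :=
  let: (a, b, c) := v in [&& (m %| a)%Z, (m %| b)%Z & (m %| c)%Z].
Definition dvd4 (m : int) (v : vec4) : bool :=
  let: (a, b, c, d) := v in [&& (m %| a)%Z, (m %| b)%Z, (m %| c)%Z & (m %| d)%Z].

Lemma dvd3P m v : reflect (exists w, v = scale3 m w) (dvd3 m v).
Proof.
case: v => [[a b] c]; apply: (iffP and3P) => [[/dvdzP[x ->] /dvdzP[y ->] /dvdzP[z ->]]|].
  by exists (x, y, z); rewrite /= !(mulrC m).
by case=> -[[x y] z] [-> -> ->]; rewrite !dvdz_mulr.
Qed.

Lemma dvd4P m v : reflect (exists w, v = scale4 m w) (dvd4 m v).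
Proof.
case: v => [[[a b] c] d]; apply: (iffP and4P) => [[]|].
  move=> /dvdzP[x ->] /dvdzP[y ->] /dvdzP[z ->] /dvdzP[t ->].
  by exists (x, y, z, t); rewrite /= !(mulrC m).
by case=> -[[[x y] z] t] [-> -> -> ->]; rewrite !dvdz_mulr.
Qed.

Lemma scale3_inj m : m != 0 -> injective (scale3 m).
Proof. by move=> m0 [[a b] c] [[x y] z] [] /(mulfI m0)-> /(mulfI m0)-> /(mulfI m0)->. Qed.

Lemma scale4_inj m : m != 0 -> injective (scale4 m).
Proof.
move=> m0 [[[a b] c] d] [[[x y] z] t] [].
by do 4!move=> /(mulfI m0)->.
Qed.

Lemma norm3_scale (m : nat) v : norm3 (scale3 m v) = (m ^ 2 * norm3 v)%N.
Proof. by case: v => [[a b] c]; rewrite /norm3 /= !abszM !expnMn !mulnDr. Qed.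

Lemma norm4_scale (m : nat) v : norm4 (scale4 m v) = (m ^ 2 * norm4 v)%N.
Proof. by case: v => [[[a b] c] d]; rewrite /norm4 /= !abszM !expnMn !mulnDr. Qed.

Lemma norm4_quat_mul k (e : int) v : e ^+ 2 = 4 ->
  norm4 (quat_mul k e v) = (5 * norm4 v)%N.
Proof.
move=> e4; apply/eqP; rewrite -eqz_nat PoszM; apply/eqP.
(* With 5 written this way the claim is a polynomial identity in e. *)
have e5 : Posz 5 = 1 + e ^+ 2 by rewrite e4.
by case: v => [[[a b] c] d]; case: k => [|[|k]]; rewrite !norm4E e5; ring.
Qed.

Lemma sqr_eq16 (e : int) : e ^+ 2 = 16 -> e = 4 \/ e = -4.
Proof.
move=> e4; have : e ^+ 2 == 4 ^+ 2 by rewrite e4.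
by rewrite eqf_sqr => /orP[] /eqP; [left | right].
Qed.

(** The map is 5 times a rotation, because 3^2 + 4^2 = 5^2. *)
Lemma norm3_quat_conj k (e : int) v : e ^+ 2 = 16 ->
  norm3 (quat_conj k e v) = (25 * norm3 v)%N.
Proof.
move=> /sqr_eq16 e4; apply/eqP; rewrite -eqz_nat PoszM; apply/eqP.
have c25 : Posz 25 = 25%:R by [].
by case: v => [[a b] c]; case: k => [|[|k]]; rewrite !norm3E c25;
  case: e4 => ->; ring.
Qed.

(** A quaternion times its conjugate is its norm, here 1 + e^2. *)
Lemma quat_mulK k (e : int) v : e ^+ 2 = 4 ->
  quat_mul k e (quat_mul k (- e) v) = scale4 5 v.
Proof.
move=> e4; have e5 : 5 = 1 + e ^+ 2 by rewrite e4.
by case: v => [[[a b] c] d]; case: k => [|[|k]] /=; rewrite e5;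
  congr (_, _, _, _); ring.
Qed.

Lemma quat_conjK k (e : int) v : e ^+ 2 = 16 ->
  quat_conj k e (quat_conj k (- e) v) = scale3 25 v.
Proof.
move=> /sqr_eq16 e4.
by case: v => [[a b] c]; case: k => [|[|k]] /=; case: e4 => ->;
  congr (_, _, _); ring.
Qed.

Lemma quat_mul_scale k e m v : quat_mul k e (scale4 m v) = scale4 m (quat_mul k e v).
Proof. by case: v => [[[a b] c] d]; case: k => [|[|k]] /=; congr (_, _, _, _); ring. Qed.

Lemma quat_conj_scale k e m v : quat_conj k e (scale3 m v) = scale3 m (quat_conj k e v).
Proof. by case: v => [[a b] c]; case: k => [|[|k]] /=; congr (_, _, _); ring. Qed.

(** For q of norm 5, v = q w has an integral solution w exactly when 5 divides conj(q) v. Hence w ->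
    q w maps the points of norm n bijectively onto the points counted. *)
Lemma count_sphere4_dvd k (e : int) n : e ^+ 2 = 4 ->
  count (fun v => dvd4 5 (quat_mul k (- e) v)) (sphere4 (5 * n)) = size (sphere4 n).
Proof.
move=> e4; have Ne4 : (- e) ^+ 2 = 4 by rewrite sqrrN.
apply: (count_image (f := quat_mul k e)); rewrite ?sphere4_uniq //.
- move=> v w /(congr1 (quat_mul k (- e))); rewrite -{2 4}[e]opprK !quat_mulK //.
  exact: scale4_inj.
- move=> v; rewrite mem_sphere4 => /eqP vn /dvd4P[w vw]; exists w.
    have := norm4_quat_mul k v Ne4; rewrite vw norm4_scale vn mem_sphere4 => E.
    by apply/eqP; lia.
  apply: (@scale4_inj 5) => //; rewrite -quat_mul_scale -vw; exact: quat_mulK.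
- move=> v; rewrite mem_sphere4 => /eqP vn; rewrite mem_sphere4 norm4_quat_mul // vn.
  by split=> //; apply/dvd4P; exists v; rewrite -{2}[e]opprK quat_mulK.
Qed.

(** Likewise, v = q w conj(q) is solvable exactly when 25 divides conj(q) v q. *)
Lemma count_sphere3_dvd k (e : int) n : e ^+ 2 = 16 ->
  count (fun v => dvd3 25 (quat_conj k (- e) v)) (sphere3 (25 * n)) = size (sphere3 n).
Proof.
move=> e4; have Ne4 : (- e) ^+ 2 = 16 by rewrite sqrrN.
apply: (count_image (f := quat_conj k e)); rewrite ?sphere3_uniq //.
- move=> v w /(congr1 (quat_conj k (- e))); rewrite -{2 4}[e]opprK !quat_conjK //.
  exact: scale3_inj.
- move=> v; rewrite mem_sphere3 => /eqP vn /dvd3P[w vw]; exists w.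
    have := norm3_quat_conj k v Ne4; rewrite vw norm3_scale vn mem_sphere3 => E.
    by apply/eqP; lia.
  apply: (@scale3_inj 25) => //; rewrite -quat_conj_scale -vw; exact: quat_conjK.
- move=> v; rewrite mem_sphere3 => /eqP vn; rewrite mem_sphere3 norm3_quat_conj // vn.
  by split=> //; apply/dvd3P; exists v; rewrite -{2}[e]opprK quat_conjK.
Qed.

Lemma count_sphere3_scale (n : nat) :
  count (dvd3 5) (sphere3 (25 * n)) = size (sphere3 n).
Proof.
apply: (count_image (f := scale3 5)); rewrite ?sphere3_uniq //.
- exact: scale3_inj.
- move=> v; rewrite mem_sphere3 => /eqP vn /dvd3P[w vw]; exists w => //.
  by rewrite mem_sphere3; apply/eqP; move: vn; rewrite vw norm3_scale; lia.
- move=> v; rewrite mem_sphere3 => /eqP vn; rewrite mem_sphere3 norm3_scale vn.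
  by split=> //; apply/dvd3P; exists v.
Qed.

(** An axis and a sign encode one of 1 + 2i, 1 - 2i, 1 + 2j, 1 - 2j, 1 + 2k, 1 - 2k. *)
Definition six_axes : seq (nat * bool) :=
  [seq (k, s) | k <- iota 0 3, s <- [:: true; false]].
Definition signed_by (s : bool) (m : int) : int := if s then m else - m.

Lemma intz_residue (m : nat) (a : int) : (0 < m)%N ->
  exists2 r : nat, r \in iota 0 m & (m %| a - r%:Z)%Z.
Proof.
move=> m0; exists `|(a %% m)%Z|%N.
  rewrite mem_iota add0n -ltz_nat gez0_abs ?ltz_pmod //.
  by apply: modz_ge0; lia.
rewrite gez0_abs; last by apply: modz_ge0; lia.
by rewrite {1}(divz_eq a m) addrK dvdz_mull.
Qed.

(* Works on residues, with -x encoded as the natural number 5 - x. *)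
Definition quat_mul_dvd5 k (s : bool) (a b c d : nat) : bool :=
  let e := if s then 2%N else 3%N in let e' := (5 - e)%N in
  let z x := (x %% 5 == 0)%N in
  match k with
  | 0 => [&& z (a + e' * b), z (b + e * a), z (c + e' * d) & z (d + e * c)]%N
  | 1 => [&& z (a + e' * c), z (b + e * d), z (c + e * a) & z (d + e' * b)]%N
  | _ => [&& z (a + e' * d), z (b + e' * c), z (c + e * b) & z (d + e * a)]%N
  end.

(** Divisibility depends only on residues, so it reduces to a test that can be evaluated on all of
    them. *)
Lemma quat_mul_dvd5E k s (a b c d : int) (a' b' c' d' : nat) :
  (5 %| a - a'%:Z)%Z -> (5 %| b - b'%:Z)%Z -> (5 %| c - c'%:Z)%Z -> (5 %| d - d'%:Z)%Z ->
  dvd4 5 (quat_mul k (signed_by s 2) (a, b, c, d)) = quat_mul_dvd5 k s a' b' c' d'.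
Proof.
move=> ha hb hc hd.
by case: s; case: k => [|[|k]]; rewrite /= /quat_mul_dvd5; congr [&& _, _, _ & _]; lia.
Qed.

Lemma allP_iota4 m (P : nat -> nat -> nat -> nat -> bool) :
  all (fun a => all (fun b => all (fun c => all (P a b c)
    (iota 0 m)) (iota 0 m)) (iota 0 m)) (iota 0 m) ->
  forall a b c d, a \in iota 0 m -> b \in iota 0 m -> c \in iota 0 m ->
    d \in iota 0 m -> P a b c d.
Proof.
move=> h a b c d am bm cm dm.
exact: (allP (allP (allP (allP h a am) b bm) c cm) d dm).
Qed.

Lemma dvdz_sqrB (m a a' : int) : (m %| a - a')%Z -> (m %| a ^+ 2 - a' ^+ 2)%Z.
Proof. by move=> h; rewrite subr_sqr dvdz_mulr. Qed.

(* A nonzero isotropic x mod 5 spans a right ideal annihilated by exactly one of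
   the six quaternions of norm 5; x = 0 is annihilated by all six. *)
Lemma count_quat_mul_dvd v : (5 %| norm4 v)%N ->
  count (fun ks => dvd4 5 (quat_mul ks.1 (signed_by ks.2 2) v)) six_axes = 1 %[mod 5].
Proof.
case: v => [[[a b] c] d] h5.
have [//|a' am ha] := @intz_residue 5 a; have [//|b' bm hb] := @intz_residue 5 b.
have [//|c' cm hc] := @intz_residue 5 c; have [//|d' dm hd] := @intz_residue 5 d.
under eq_count => ks do rewrite (quat_mul_dvd5E _ _ ha hb hc hd).
have {}h5 : (5 %| a' ^ 2 + b' ^ 2 + c' ^ 2 + d' ^ 2)%N.
  have := norm4E a b c d; move: h5.
  move: (dvdz_sqrB ha) (dvdz_sqrB hb) (dvdz_sqrB hc) (dvdz_sqrB hd).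
  by lia.
apply/eqP; move: h5; apply/implyP.
move: a' b' c' d' am bm cm dm {ha hb hc hd}; apply: (@allP_iota4 5 (fun a' b' c' d' : nat =>
  (5 %| a' ^ 2 + b' ^ 2 + c' ^ 2 + d' ^ 2)%N ==>
  (count (fun ks => quat_mul_dvd5 ks.1 ks.2 a' b' c' d') six_axes == 1 %[mod 5])%N)).
by vm_compute.
Qed.

Lemma sum_count_exchange (S T : Type) (s : seq S) (t : seq T) (P : S -> T -> bool) :
  (\sum_(x <- s) count (P x) t = \sum_(y <- t) count (P^~ y) s)%N.
Proof.
under eq_bigr => x _ do rewrite -sum1_count big_mkcond.
rewrite exchange_big; apply: eq_bigr => y _.
by rewrite -sum1_count [RHS]big_mkcond.
Qed.

Lemma eq_modn_natr (m n : nat) : (m = n %[mod 5])%N <-> m%:R = n%:R :> 'F_5.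
Proof.
split=> [E|/(congr1 val)]; last by rewrite /= !val_Fp_nat.
by apply: val_inj; rewrite /= !val_Fp_nat.
Qed.

(** Double counting of pairs (v, q) where q divides v on the left: each of the six q contributes
    r_4(n), and each v contributes 1 modulo 5. *)
Lemma size_sphere4 n : (size (sphere4 (5 * n)))%:R = (size (sphere4 n))%:R :> 'F_5.
Proof.
have E : (\sum_(v <- sphere4 (5 * n))
    count (fun ks => dvd4 5 (quat_mul ks.1 (signed_by ks.2 2) v)) six_axes =
    6 * size (sphere4 n))%N.
  rewrite sum_count_exchange (eq_bigr (fun=> size (sphere4 n))).
    by rewrite big_const_seq count_predT iter_addn addn0 mulnC.
  case=> k s _ /=; rewrite -(opprK (signed_by s 2)) count_sphere4_dvd //.
  by case: s.
have : (6 * size (sphere4 n))%:R = (size (sphere4 n))%:R :> 'F_5.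
  by rewrite (_ : 6 = 1 + 5)%N // mulnDl natrD mul1n natrM pchar_Fp_0 // mul0r addr0.
rewrite -E natr_sum => <-; rewrite -sum1_size natr_sum.
apply: eq_big_seq => v; rewrite mem_sphere4 => /eqP vn.
by apply/eq_modn_natr; rewrite count_quat_mul_dvd // vn dvdn_mulr.
Qed.

(** * Sums of three squares *)

(** Residue version of divisibility by m, with -x encoded through m - x; it serves for m = 5 and m =
    25. *)
Definition quat_conj_dvdn (m : nat) k (s : bool) (a b c : nat) : bool :=
  let e := if s then 4%N else (m - 4)%N in
  let z x := (x %% m == 0)%N in
  match k with
  | 0 => [&& z (5 * a), z ((m - 3) * b + (m - e) * c) & z (e * b + (m - 3) * c)]%N
  | 1 => [&& z (e * c + (m - 3) * a), z (5 * b) & z ((m - 3) * c + (m - e) * a)]%N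
  | _ => [&& z ((m - 3) * a + (m - e) * b), z (e * a + (m - 3) * b) & z (5 * c)]%N
  end.

Lemma quat_conj_dvd5E k s (a b c : int) (a' b' c' : nat) :
  (5 %| a - a'%:Z)%Z -> (5 %| b - b'%:Z)%Z -> (5 %| c - c'%:Z)%Z ->
  dvd3 5 (quat_conj k (signed_by s 4) (a, b, c)) = quat_conj_dvdn 5 k s a' b' c'.
Proof.
move=> ha hb hc.
by case: s; case: k => [|[|k]]; rewrite /= /quat_conj_dvdn; congr [&& _, _ & _]; lia.
Qed.

Lemma quat_conj_dvd25E k s (a b c : int) (a' b' c' : nat) :
  (25 %| a - a'%:Z)%Z -> (25 %| b - b'%:Z)%Z -> (25 %| c - c'%:Z)%Z ->
  dvd3 25 (quat_conj k (signed_by s 4) (a, b, c)) = quat_conj_dvdn 25 k s a' b' c'.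
Proof.
move=> ha hb hc.
by case: s; case: k => [|[|k]]; rewrite /= /quat_conj_dvdn; congr [&& _, _ & _]; lia.
Qed.

Lemma allP_iota3 m (P : nat -> nat -> nat -> bool) :
  all (fun a => all (fun b => all (P a b) (iota 0 m)) (iota 0 m)) (iota 0 m) ->
  forall a b c, a \in iota 0 m -> b \in iota 0 m -> c \in iota 0 m -> P a b c.
Proof. by move=> h a b c am bm cm; apply: (allP (allP (allP h a am) b bm) c cm). Qed.

(** Modulo 5 each condition is one linear equation between two coordinates; all residue triples are
    checked. It gives the weight of the points 5 v in the count for norm 25 n. *)
Lemma count_quat_conj_dvd5 v :
  count (fun ks => dvd3 5 (quat_conj ks.1 (signed_by ks.2 4) v)) six_axes
  = 1 + norm3 v ^ 2 %[mod 5].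
Proof.
case: v => [[a b] c].
have [//|a' am ha] := @intz_residue 5 a; have [//|b' bm hb] := @intz_residue 5 b.
have [//|c' cm hc] := @intz_residue 5 c.
under eq_count => ks do rewrite (quat_conj_dvd5E _ _ ha hb hc).
have E : norm3 (a, b, c) = a' ^ 2 + b' ^ 2 + c' ^ 2 %[mod 5].
  have := norm3E a b c.
  move: (dvdz_sqrB ha) (dvdz_sqrB hb) (dvdz_sqrB hc).
  by lia.
rewrite -modnDmr -modnXm E modnXm modnDmr; apply/eqP.
move: a' b' c' am bm cm {ha hb hc E}; apply: (@allP_iota3 5 (fun a' b' c' : nat =>
  (count (fun ks => quat_conj_dvdn 5 ks.1 ks.2 a' b' c') six_axes ==
   1 + (a' ^ 2 + b' ^ 2 + c' ^ 2) ^ 2 %[mod 5])%N)).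
by vm_compute.
Qed.

(** If v = q w conj(q) is nonzero modulo 5, its right ideal modulo 5 is that of q, which singles out
    one of the six. The count is verified over residues modulo 25. *)
Lemma count_quat_conj_dvd25 v : (25 %| norm3 v)%N -> ~~ dvd3 5 v ->
  count (fun ks => dvd3 25 (quat_conj ks.1 (signed_by ks.2 4) v)) six_axes = 1 %[mod 5].
Proof.
case: v => [[a b] c] h25 h5.
have [//|a' am ha] := @intz_residue 25 a; have [//|b' bm hb] := @intz_residue 25 b.
have [//|c' cm hc] := @intz_residue 25 c.
under eq_count => ks do rewrite (quat_conj_dvd25E _ _ ha hb hc).
have {}h25 : ((a' ^ 2 %% 25 + b' ^ 2 %% 25 + c' ^ 2 %% 25) %% 25 = 0)%N.
  have := norm3E a b c; move: h25.
  move: (dvdz_sqrB ha) (dvdz_sqrB hb) (dvdz_sqrB hc).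
  by lia.
have {}h5 : ~~ [&& a' %% 5 == 0, b' %% 5 == 0 & c' %% 5 == 0]%N.
  by move: h5; rewrite /dvd3 => h5; lia.
apply/eqP; move: h25 h5 => /eqP h25 h5; move: h25 h5.
(* A table of squares replaces the powers in the exhaustive check. *)
pose sq := [seq i ^ 2 %% 25 | i <- iota 0 25]%N.
have sqE i : i \in iota 0 25 -> (i ^ 2 %% 25 = nth 0 sq i)%N.
  by rewrite mem_iota => hi; rewrite (nth_map 0%N) ?size_iota // nth_iota.
rewrite (sqE _ am) (sqE _ bm) (sqE _ cm) => h25 h5; move: h25; apply/implyP; move: h5.
apply/implyP.
move: a' b' c' am bm cm {ha hb hc}; apply: (@allP_iota3 25 (fun a' b' c' : nat =>
  ~~ [&& a' %% 5 == 0, b' %% 5 == 0 & c' %% 5 == 0] ==>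
  (((nth 0 sq a' + nth 0 sq b' + nth 0 sq c') %% 25 == 0) ==> 
  (count (fun ks => quat_conj_dvdn 25 ks.1 ks.2 a' b' c') six_axes ==
   1 %[mod 5])))%N).
by vm_compute.
Qed.

(** Double counting again: the total is 6 r_3(n), while points divisible by 5 weigh 1 + n^2 and the
    others 1. Hence r_3(n) = r_3(25 n) + n^2 r_3(n). *)
Lemma size_sphere3 n : (size (sphere3 (25 * n)))%:R =
  (1 - n%:R ^+ 2) * (size (sphere3 n))%:R :> 'F_5.
Proof.
have E : (\sum_(v <- sphere3 (25 * n))
    count (fun ks => dvd3 25 (quat_conj ks.1 (signed_by ks.2 4) v)) six_axes =
    6 * size (sphere3 n))%N.
  rewrite sum_count_exchange (eq_bigr (fun=> size (sphere3 n))).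
    by rewrite big_const_seq count_predT iter_addn addn0 mulnC.
  case=> k s _ /=; rewrite -(opprK (signed_by s 4)) count_sphere3_dvd //.
  by case: s.
have : (6 * size (sphere3 n))%:R = (size (sphere3 n))%:R :> 'F_5.
  by rewrite (_ : 6 = 1 + 5)%N // mulnDl natrD mul1n natrM pchar_Fp_0 // mul0r addr0.
rewrite -E natr_sum.
have loc v : v \in sphere3 (25 * n) ->
    (count (fun ks => dvd3 25 (quat_conj ks.1 (signed_by ks.2 4) v)) six_axes)%:R
    = 1 + (dvd3 5 v)%:R * n%:R ^+ 2 :> 'F_5.
  rewrite mem_sphere3 => /eqP vn; case: (boolP (dvd3 5 v)) => [/dvd3P[w vw]|ndv].
    have wn : norm3 w = n by move: vn; rewrite vw norm3_scale; lia.
    rewrite mul1r -natrX -wn -[1]/(1%:R) -natrD; apply/eq_modn_natr.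
    rewrite -count_quat_conj_dvd5; congr (_ %% _)%N; apply: eq_count => ks.
    (* For v = 5 w, divisibility by 25 after conjugation becomes divisibility by 5 for w. *)
    rewrite vw quat_conj_scale; case: (quat_conj _ _ w) => [[a b] c] /=.
    by congr [&& _, _ & _]; lia.
  rewrite mul0r addr0 -[RHS]/(1%:R); apply/eq_modn_natr.
  by rewrite count_quat_conj_dvd25 // vn dvdn_mulr.
rewrite (eq_big_seq _ loc) big_split /= -mulr_suml -natr_sum.
rewrite -big_mkcond /= sum1_count count_sphere3_scale.
rewrite big_const_seq count_predT iter_addr_0 => /(canRL (addrK _)) ->.
ring.
Qed.

(** * Generating functions of overpartitions *)

Local Notation part := (nat * bool)%type.

Lemma overpartition_cons n (x : part) s : overpartition n (x :: s) =
  [&& (0 < x.1)%N, (x.1 <= n)%N, overpartition (n - x.1) s,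
      all (fun y => y.1 <= x.1)%N s & all (fun y => y.2 ==> (y.1 != x.1)) s].
Proof.
rewrite /overpartition big_cons /=.
have -> : (x.1 + \sum_(y <- s) y.1 == n)%N =
    (x.1 <= n)%N && (\sum_(y <- s) y.1 == n - x.1)%N by lia.
case: (0 < x.1)%N; case: (x.1 <= n)%N; case: (_ == _) => //=;
  do ?[case: (all _ _) => //=]; do ?[case: (pairwise _ _) => //=].
Qed.

Lemma prod_nat_recr_cond (A : comNzRingType) (P : pred nat) (F : nat -> A) k :
  \prod_(1 <= i < k.+2 | P i) F i =
  \prod_(1 <= i < k.+1 | P i) F i * (if P k.+1 then F k.+1 else 1).
Proof. by rewrite big_mkcond big_nat_recr //= [in RHS]big_mkcond. Qed.

Section Overpartitions.
Implicit Types (C : pred part) (s : seq part).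

Definition overparts C n : seq (seq part) :=
  [seq parts_of t | t in [set t : n.-bseq ('I_n.+1 * bool)
      | overpartition n (parts_of t) & all C (parts_of t)]].

Lemma overparts_uniq C n : uniq (overparts C n).
Proof. by rewrite map_inj_uniq ?enum_uniq //; apply: parts_of_inj. Qed.

Lemma mem_overparts C n s : (s \in overparts C n) = overpartition n s && all C s.
Proof.
apply/imageP/andP => [[t + ->]|[ns Cs]]; first by rewrite inE => /andP.
have [t ts] := overpartition_parts_of ns.
by exists t; rewrite // inE ts ns.
Qed.

Lemma size_overparts C n : size (overparts C n) =
  #|[set t : n.-bseq ('I_n.+1 * bool)
      | overpartition n (parts_of t) & all C (parts_of t)]|.
Proof. by rewrite size_image. Qed.

Lemma size_overparts_eq C C' n :
  (forall x, (0 < x.1 <= n)%N -> C x = C' x) ->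
  size (overparts C n) = size (overparts C' n).
Proof.
move=> CC; apply/perm_size/uniq_perm; rewrite ?overparts_uniq // => s.
rewrite !mem_overparts; case: (boolP (overpartition n s)) => //= /and4P[s0 /eqP sn _ _].
apply: eq_in_all => x xs; apply: CC; rewrite (allP s0 _ xs) /=.
by rewrite -sn (big_rem x xs) leq_addr.
Qed.

(** Split by whether the list starts with [(m, b)]. As m is the largest size and an overlined m can
    only come first, what follows such a head lies in [C1] for either value of b. *)
Lemma size_overparts_rec C m b n : (0 < m)%N -> (forall x, C x -> (x.1 < m)%N) ->
  let C1 x := C x || (x == (m, false)) in
  let D x := if b then C1 x else C x in
  size (overparts (fun x => D x || (x == (m, b))) n) =
  (size (overparts D n) + if m <= n then size (overparts C1 (n - m)) else 0)%N.
Proof.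
move=> m0 Cm C1 D.
pose S := if (m <= n)%N then map (cons (m, b)) (overparts C1 (n - m)) else [::].
have -> : (if m <= n then size (overparts C1 (n - m)) else 0)%N = size S.
  by rewrite /S; case: ifP => // _; rewrite size_map.
have Dmb : ~~ D (m, b).
  rewrite /D /C1; case: b {D S}; last by apply/negP => /Cm; rewrite ltnn.
  by rewrite eqE /= eqE /= andbF orbF; apply/negP => /Cm; rewrite ltnn.
have memS s : (s \in S) = if s is x :: s' then
    [&& x == (m, b), m <= n & s' \in overparts C1 (n - m)]%N else false.
  rewrite /S; case: ifP => _; last by case: s => // x s; rewrite in_nil andbF.
  apply/mapP/idP => [[s' s'S ->]|]; first by rewrite eqxx.
  by case: s => // x s /and3P[/eqP -> _ sS]; exists s.
have C1m y : C1 y -> (y.1 <= m)%N && (y.2 ==> (y.1 != m)).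
  case/orP => [/Cm ym|/eqP -> /=]; last by rewrite leqnn.
  by rewrite ltnW //= neq_ltn ym implybT.
rewrite -size_cat; apply/perm_size/uniq_perm; first exact: overparts_uniq.
  rewrite cat_uniq overparts_uniq /=; apply/andP; split.
    apply/hasP => -[s]; rewrite memS mem_overparts; case: s => // x s.
    by case/and3P => /eqP -> _ _ /andP[_ /= /andP[]]; rewrite (negPf Dmb).
  by rewrite /S; case: ifP => // _; rewrite map_inj_uniq ?overparts_uniq // => s s' [].
move=> s; rewrite mem_cat memS !mem_overparts.
case: s => [|x s]; first by rewrite orbF.
rewrite !overpartition_cons /= mem_overparts; case: (altP (x =P (m, b))) => [->|xmb] /=.
  rewrite orbT (negPf Dmb) /= !andbF /= m0 /=; case: (m <= n)%N => //=.
  case: (overpartition _ s) => //=; rewrite -!all_predI; apply: eq_all => y /=.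
  rewrite /D; apply/idP/idP => [|C1y].
    case: b {S D Dmb memS} => /=; last first.
      by case/andP=> _.
    by case/andP=> /andP[_ nm] /orP[//|/eqP E]; rewrite E /= eqxx in nm.
  case/andP: (C1m _ C1y) => -> -> /=; case: b {S D Dmb memS} => //.
  by rewrite C1y.
rewrite !orbF; apply: andb_id2l => /and5P[_ _ _ le_x ov_x].
apply: andb_id2l => Dx; apply: eq_in_all => y ys.
(* [(m, b)] cannot stand behind another head x: its size forces x to have size m, which contradicts
   [C x] if b is false and the overline rule if b is true. *)
case: eqP => [ymb|_]; last by rewrite orbF.
have := allP le_x _ ys; have := allP ov_x _ ys; rewrite ymb /= => ov mx.
move: Dx; rewrite /D; case: b ov {S D Dmb memS xmb ymb} => /= [mNx /C1m/andP[xm _]|_ /Cm].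
  by case/eqP: mNx; apply/eqP; rewrite eqn_leq mx xm.
by rewrite ltnNge mx.
Qed.

Variable R : comNzRingType.

Definition overparts_gf C : fps R := Fps (fun n => (size (overparts C n))%:R).

(** Plain copies of m contribute 1/(1 - q^m), the optional overlined one 1 + q^m. *)
Lemma overparts_gf_rec C m : (0 < m)%N -> (forall x, C x -> (x.1 < m)%N) ->
  (1 - fpsX ^+ m) * overparts_gf (fun x => C x || (x.1 == m)) =
  (1 + fpsX ^+ m) * overparts_gf C.
Proof.
move=> m0 Cm; pose C1 x := C x || (x == (m, false)).
have rec0 : overparts_gf C1 = overparts_gf C + fpsX ^+ m * overparts_gf C1.
  apply: fpsP => n; rewrite cfD cfXnM /= (size_overparts_rec false) // natrD.
  by case: ifP.
have rec1 : overparts_gf (fun x => C x || (x.1 == m)) =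
    overparts_gf C1 + fpsX ^+ m * overparts_gf C1.
  apply: fpsP => n; rewrite cfD cfXnM /=.
  have -> : size (overparts (fun x => C x || (x.1 == m)) n) =
      size (overparts (fun x => C1 x || (x == (m, true))) n).
    apply: size_overparts_eq => -[i b] _; rewrite /C1 -orbA; congr orb => /=.
    by rewrite !xpair_eqE; case: b; rewrite /= ?andbT ?andbF ?orbF.
  by rewrite (size_overparts_rec true) // natrD; case: ifP.
rewrite rec1; set G := overparts_gf C1.
transitivity ((1 + fpsX ^+ m) * ((1 - fpsX ^+ m) * G)); first by ring.
congr (_ * _).
by rewrite mulrBl mul1r {1}/G rec0 addrK.
Qed.

Definition regular l : pred part := fun x => ~~ (l %| x.1)%N.
Definition regular_le l k : pred part := fun x => regular l x && (x.1 <= k)%N.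

Lemma overparts_gf_prod l k :
  \prod_(1 <= i < k.+1 | ~~ (l %| i)%N) (1 - fpsX ^+ i) * overparts_gf (regular_le l k) =
  \prod_(1 <= i < k.+1 | ~~ (l %| i)%N) (1 + fpsX ^+ i).
Proof.
elim: k => [|k IH].
  rewrite !big_geq // mul1r; apply: fpsP => n; rewrite cf1 /=.
  have -> : size (overparts (regular_le l 0) n) = size (overparts (pred0 : pred part) n).
    by apply: size_overparts_eq => x /andP[x0 _]; rewrite /regular_le leqNgt x0 andbF.
  suff -> : size (overparts pred0 n) = (n == 0%N) by [].
  have -> : (n == 0%N : nat) = size (if n == 0%N then [:: [::] : seq part] else [::]).
    by case: eqP.
  apply/perm_size/uniq_perm; first exact: overparts_uniq; first by case: eqP.
  move=> s; rewrite mem_overparts; case: s => [|x s] /=.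
    by rewrite /overpartition big_nil /= eq_sym andbT; case: eqP.
  by rewrite andbF; case: eqP.
rewrite !prod_nat_recr_cond; case: ifPn => lk; last first.
  rewrite !mulr1 -IH; congr (_ * _); apply: fpsP => n /=; congr (_%:R).
  apply: size_overparts_eq => x _; rewrite /regular_le leq_eqVlt ltnS /regular.
  case: eqP => // ->; move: lk; rewrite negbK => -> /=; first by [].
rewrite -mulrA; set A := overparts_gf _.
have -> : A = overparts_gf (fun x => regular_le l k x || (x.1 == k.+1)).
  apply: fpsP => n /=; congr (_%:R); apply: size_overparts_eq => x _.
  rewrite /regular_le leq_eqVlt ltnS orbC andb_orr; congr orb.
  by case: eqP => [E|]; rewrite ?andbF // andbT /regular E.
rewrite overparts_gf_rec // => [|x /andP[_]]; last by rewrite ltnS.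
by rewrite mulrCA IH mulrC.
Qed.

Lemma overparts_gf_approx l k :
  fps_eqm k.+1 (overparts_gf (regular l)) (overparts_gf (regular_le l k)).
Proof.
move=> n nk /=; congr (_%:R); apply: size_overparts_eq => x /andP[_ xn].
by rewrite /regular_le (leq_trans xn) ?andbT.
Qed.

End Overpartitions.

Lemma overlineAE l n : overlineA l n = size (overparts (regular l) n).
Proof. by rewrite size_overparts. Qed.

(** * The theta series *)

Section Theta.
Variable R : comNzRingType.

(** Partial sum n already settles coefficient n, as later exponents j^2 exceed n. *)
Definition theta : fps R := Fps (fun n => cf (theta_sum fpsX n) n).

Lemma cf_theta_sum N n : (n <= N)%N -> cf (theta_sum (fpsX : fps R) N) n = cf theta n.
Proof.
elim: N => [|N IH]; first by rewrite leqn0 => /eqP ->.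
rewrite leq_eqVlt ltnS => /orP[/eqP -> //|nN].
rewrite theta_sumS cfD IH // [2 * _ * _]mulrC cfXnM ifF ?addr0 //.
by apply/negbTE; rewrite -ltnNge; apply: leq_trans (leq_self_sqr N.+1).
Qed.

Lemma theta_approx N : fps_eqm N.+1 theta (theta_sum fpsX N).
Proof. by move=> n nN; rewrite cf_theta_sum. Qed.

Lemma cf_theta n :
  cf theta n = (n == 0%N)%:R + 2 * \sum_(1 <= j < n.+1) (-1) ^+ j * (n == j ^ 2)%N%:R.
Proof.
rewrite -[LHS]/(cf (theta_sum fpsX n) n) /theta_sum cfD cf1 !mulr_natl.
rewrite !mulr2n cfD cf_sum -!mulr2n; congr (_ + _ *+ 2).
by apply: eq_bigr => j _; rewrite cf_sign cfXn.
Qed.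

Lemma cf_theta_nonsquare n : (forall j, n <> (j ^ 2)%N) -> cf theta n = 0.
Proof.
move=> nsq; rewrite cf_theta big1 => [|j _].
  by case: eqP => [n0|]; [case: (nsq 0%N) | rewrite mulr0 addr0].
by case: eqP => [/nsq|]; rewrite ?mulr0.
Qed.

Lemma cf_theta_square j :
  cf theta (j ^ 2) = if j == 0%N then 1 else 2 * (-1) ^+ j.
Proof.
rewrite cf_theta; case: j => [|j]; first by rewrite big_geq // mulr0 addr0.
rewrite add0r (bigD1_seq j.+1) ?iota_uniq //=; last first.
  by rewrite mem_index_iota /= ltnS leq_self_sqr.
rewrite eqxx mulr1 big1 ?addr0 // => i ij.
by rewrite eqn_exp2r // eq_sym (negPf ij) mulr0.
Qed.

(** Since j and j^2 have the same parity, th is the sum of (-q)^(x^2) over all integers x, so its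
    powers count lattice points up to the sign (-1)^n. *)
Lemma theta_sum_zbox N :
  theta_sum (fpsX : fps R) N = \sum_(x <- zbox N) (- fpsX) ^+ (`|x| ^ 2)%N.
Proof.
rewrite (sum_zbox (fun j => (- fpsX) ^+ (j ^ 2)%N)) /theta_sum mulr_natl; congr (_ + _ *+ 2).
apply: eq_bigr => j _; rewrite [in RHS]exprNn; congr (_ * _).
by rewrite -signr_odd -[in RHS]signr_odd oddX.
Qed.

Lemma mul_sum_exp (A : comNzRingType) (y : A) (S T : Type) (s : seq S) (t : seq T)
    (f : S -> nat) (g : T -> nat) :
  (\sum_(a <- s) y ^+ f a) * (\sum_(b <- t) y ^+ g b) =
  \sum_(c <- [seq (a, b) | a <- s, b <- t]) y ^+ (f c.1 + g c.2).
Proof.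
rewrite big_allpairs mulr_suml; apply: eq_bigr => a _.
by rewrite mulr_sumr; apply: eq_bigr => b _; rewrite exprD.
Qed.

Lemma cf_sum_expNX (T : Type) (s : seq T) (f : T -> nat) n :
  cf (\sum_(x <- s) (- fpsX : fps R) ^+ f x) n =
  (-1) ^+ n * (count (fun x => f x == n) s)%:R.
Proof.
rewrite cf_sum -sum1_count natr_sum mulr_sumr [RHS]big_mkcond.
apply: eq_bigr => x _; rewrite (exprNn fpsX) cf_sign cfXn eq_sym.
by case: eqP => [->|_] /=; rewrite ?mulr0 ?mulr1.
Qed.

Lemma cf_theta3 n : cf (theta ^+ 3) n = (-1) ^+ n * (size (sphere3 n))%:R.
Proof.
rewrite (fps_eqm_exp 3 (@theta_approx n)) // theta_sum_zbox !exprSr expr0 mul1r.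
rewrite !mul_sum_exp cf_sum_expNX size_filter; congr (_ * _%:R).
by apply: eq_count => -[[a b] c].
Qed.

Lemma cf_theta4 n : cf (theta ^+ 4) n = (-1) ^+ n * (size (sphere4 n))%:R.
Proof.
rewrite (fps_eqm_exp 4 (@theta_approx n)) // theta_sum_zbox !exprSr expr0 mul1r.
rewrite !mul_sum_exp cf_sum_expNX size_filter; congr (_ * _%:R).
by apply: eq_count => -[[[a b] c] d].
Qed.

Lemma cf0_theta : cf theta 0 = 1.
Proof. by rewrite -[0%N]/(0 ^ 2)%N cf_theta_square. Qed.

Lemma theta_gauss n :
  fps_eqm n.+1 (theta * prod_plus fpsX n.+1) (prod_minus fpsX 1 n.+1).
Proof.
apply: (@fps_eqm_trans _ _ _ (theta_sum fpsX n * prod_plus fpsX n.+1)).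
  by apply: fps_eqm_mul => //; apply: theta_approx.
by have [r ->] := theta_sum_approx (fpsX : fps R) n; apply: fps_eqm_DXn.
Qed.

Lemma cf0_prod_plus (P : pred nat) n :
  cf (\prod_(1 <= i < n | P i) (1 + fpsX ^+ i) : fps R) 0 = 1.
Proof.
rewrite big_seq_cond; apply: (big_ind (fun f : fps R => cf f 0 = 1)) => //.
  by move=> f g f0 g0; rewrite cf0M f0 g0 mulr1.
move=> [|i] /andP[]; rewrite mem_index_iota // => _ _.
by rewrite cfD cf1 cfXn addr0.
Qed.

End Theta.

Lemma prod_multiples (A : comNzRingType) (F : nat -> A) l N : (0 < l)%N ->
  \prod_(1 <= i < (l * N).+1 | (l %| i)%N) F i = \prod_(1 <= j < N.+1) F (l * j)%N.
Proof.
move=> l0; rewrite -big_filter -[RHS](big_map (muln l) xpredT F); apply: perm_big.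
have inj : injective (muln l) by move=> a b /eqP; rewrite eqn_pmul2l // => /eqP.
apply: uniq_perm; rewrite ?filter_uniq ?map_inj_uniq ?iota_uniq // => i.
rewrite mem_filter mem_index_iota; apply/andP/mapP => [[/dvdnP[j ->]]|[j]].
  rewrite mulnC ltnS muln_gt0 leq_pmul2l // => /andP[/andP[_ j0] jN].
  by exists j; rewrite // mem_index_iota j0.
rewrite mem_index_iota ltnS => /andP[j0 jN] ->.
by rewrite dvdn_mulr // muln_gt0 l0 j0 ltnS leq_pmul2l.
Qed.

(** * Reduction modulo 5 *)

Local Notation th := (theta 'F_5).
Local Notation U5 := (fps_dissect 5).

Lemma exprD125 (f g : fps 'F_5) : (f + g) ^+ 125 = f ^+ 125 + g ^+ 125.
Proof. by apply: exprDn_pchar; rewrite (eq_pnat _ (pcharf_eq (pchar_fps _))). Qed.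

(** In terms of quotients: A = Q/P, t = PF/(QE) and T = F/E give t A = T. *)
Lemma fps_eqm_quotient N (A t T P Q E F : fps 'F_5) :
  cf Q 0 = 1 -> cf E 0 = 1 -> fps_eqm N (P * A) Q ->
  fps_eqm N (t * (Q * E)) (P * F) -> fps_eqm N (T * E) F ->
  fps_eqm N (t * A) T.
Proof.
move=> Q0 E0 PA tQE TE; apply: (@fps_eqm_cancel _ N (Q * E)).
  by rewrite cf0M Q0 E0 mulr1.
have refl f : fps_eqm N f f by [].
apply: (@fps_eqm_trans _ _ _ (A * (P * F))).
  rewrite (_ : _ * (t * A) = A * (t * (Q * E))); last by ring.
  exact: fps_eqm_mul.
apply: (@fps_eqm_trans _ _ _ (Q * F)).
  by rewrite mulrA [A * P]mulrC; apply: fps_eqm_mul.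
rewrite -mulrA; apply: fps_eqm_mul => //.
by rewrite mulrC; apply: fps_eqm_sym.
Qed.

(** It suffices that th A = th^125. The factors of Gauss' product at multiples of 125 form a 125th
    power modulo 5, and by Gauss again their quotient is th^125; the other factors give 1/A. *)
Lemma overparts_gf_theta : overparts_gf 'F_5 (regular 125) = th ^+ 124.
Proof.
apply: (@fps_cancel _ th); first exact: cf0_theta.
rewrite -exprS; apply: fpsP => N.
(* The multiples of 125 up to K are then 125 i with 1 <= i <= N. *)
set A := overparts_gf _ _; pose K := (125 * N)%N.
pose P := \prod_(1 <= i < K.+1 | ~~ (125 %| i)%N) (1 - fpsX ^+ i) : fps 'F_5.
pose Q := \prod_(1 <= i < K.+1 | ~~ (125 %| i)%N) (1 + fpsX ^+ i) : fps 'F_5.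
pose D := prod_plus fpsX N.+1 : fps 'F_5.
pose M := prod_minus fpsX 1 N.+1 : fps 'F_5.
have NK : (N < K.+1)%N by rewrite ltnS leq_pmull.
have DK : prod_plus fpsX K.+1 = Q * D ^+ 125.
  rewrite /prod_plus (bigID (fun i => 125 %| i)%N)
    (prod_multiples _ _ (isT : 0 < 125)%N) mulrC.
  congr (_ * _); rewrite -prodrXl; apply: eq_bigr => i _.
  by rewrite exprD125 expr1n -exprM mulnC.
have MK : prod_minus fpsX 1 K.+1 = P * M ^+ 125.
  rewrite /prod_minus (bigID (fun i => 125 %| i)%N)
    (prod_multiples _ _ (isT : 0 < 125)%N) mulrC.
  congr (_ * _); rewrite -prodrXl; apply: eq_bigr => i _.
  by rewrite exprD125 expr1n exprNn -signr_odd mulN1r -exprM mulnC.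
have weaken (f g : fps 'F_5) : fps_eqm K.+1 f g -> fps_eqm N.+1 f g.
  by move=> fg n nN; apply: fg; apply: leq_trans nN _.
have gaussK := weaken _ _ (@theta_gauss 'F_5 K).
have gaussN := fps_eqm_exp 125 (@theta_gauss 'F_5 N).
have AP : fps_eqm N.+1 (P * A) Q.
  apply: weaken; rewrite -[Q]overparts_gf_prod.
  by apply: fps_eqm_mul => //; apply: overparts_gf_approx.
rewrite DK MK in gaussK; rewrite exprMn in gaussN.
apply: (fps_eqm_quotient _ _ AP gaussK gaussN) (ltnSn N).
  exact: cf0_prod_plus.
have D1 : cf D 0 = 1 by apply: cf0_prod_plus.
by elim: 125%N => [|k IH] //; rewrite exprS cf0M D1 IH mulr1.
Qed.

(** * Identities for powers of th modulo 5 *)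

Lemma dissect_theta4 : U5 (th ^+ 4) = th ^+ 4.
Proof.
apply: fpsP => n; rewrite cf_dissect !cf_theta4 size_sphere4; congr (_ * _).
by rewrite exprM -[_ ^+ 5]signr_odd.
Qed.

Lemma dissect_theta3 :
  fps_dissect 25 (th ^+ 3) = th ^+ 3 - fps_euler (fps_euler (th ^+ 3)).
Proof.
apply: fpsP => n; rewrite cfB !cf_euler cf_dissect !cf_theta3 size_sphere3.
have -> : (-1) ^+ (25 * n) = (-1) ^+ n :> 'F_5 by rewrite exprM -[_ ^+ 25]signr_odd.
by ring.
Qed.

(* The coefficient of [th] at j^2 is multiplied by j^4, which is 1 mod 5 unless
   5 divides j. *)
Lemma euler2_theta : fps_euler (fps_euler th) = th - th ^+ 25.
Proof.
apply: fpsP => n; rewrite cfB !cf_euler (exprM th 5 5) !cf_frobenius // mulrA.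
case: (pselect (exists j, n = j ^ 2)%N) => [[j ->]|nsq]; last first.
  have {}nsq j : n <> (j ^ 2)%N by move=> E; apply: nsq; exists j.
  rewrite [cf th n]cf_theta_nonsquare // mulr0 sub0r; apply/esym/eqP; rewrite oppr_eq0.
  apply/eqP; case: ifP => // n5; case: ifP => // n25.
  rewrite cf_theta_nonsquare // => j E; apply: (nsq (5 * j)%N).
  by rewrite expnMn -E; lia.
case: (boolP (5 %| j)%N) => [/dvdnP[i ->]|j5].
  have sqE : ((i * 5) ^ 2 = 5 * (5 * i ^ 2))%N by rewrite expnMn; lia.
  (* The signs agree because i and 5 i have the same parity. *)
  have -> : cf th ((i * 5) ^ 2) = cf th (i ^ 2).
    by rewrite !cf_theta_square muln_eq0 orbF mulnC exprM -[_ ^+ 5]signr_odd.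
  rewrite sqE dvdn_mulr // !mulKn // dvdn_mulr // natrM pchar_Fp_0 // !mul0r.
  by rewrite subrr.
rewrite Euclid_dvdX // (negPf j5) subr0.
suff -> : (j ^ 2)%:R * (j ^ 2)%:R = 1 :> 'F_5 by rewrite mul1r.
have j0 : j%:R != 0 :> 'F_5 by rewrite -(dvdn_pcharf (pchar_Fp (isT : prime 5))).
(* Multiplying j^4 = 1 by j turns it into Fermat's j^5 = j. *)
apply: (mulfI j0); rewrite mulr1 natrX -exprD -exprS.
exact: (Fp_fermat (isT : prime 5)).
Qed.


Theorem theorem8 (n : nat) :
  overlineA 125 (25 * n) = overlineA 125 (625 * n) %[mod 5].
Proof.
have frob := fps_dissect_mulXp (isT : prime 5).
rewrite !overlineAE; apply/eq_modn_natr.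
pose A := overparts_gf 'F_5 (regular 125).
have U5A : U5 A = th ^+ 28.
  (* The fifth power (th^24)^5 leaves U_5 as th^24, and U_5(th^4) = th^4 gives the exponent 28. *)
  rewrite /A overparts_gf_theta (_ : 124 = 4 + 24 * 5)%N // exprD exprM frob.
  by rewrite dissect_theta4 -exprD.
have U25A : fps_dissect 25 A = U5 (th ^+ 3) * th ^+ 5.
  rewrite (_ : 25 = 5 * 5)%N // -fps_dissect_comp U5A (_ : 28 = 3 + 5 * 5)%N //.
  by rewrite exprD exprM frob.
have U625A : fps_dissect 625 A = U5 (fps_dissect 25 (th ^+ 3) * th).
  rewrite (_ : 625 = 25 * 5 * 5)%N // -!fps_dissect_comp U25A frob.
  by rewrite fps_dissect_comp.
have parts (f g : fps 'F_5) : U5 (fps_euler f * g) = - U5 (f * fps_euler g).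
  have := fps_dissect_euler (isT : prime 5) (f * g); rewrite fps_eulerM.
  by move=> /(congr1 (fun h => h - U5 (f * fps_euler g))); rewrite -fps_dissectB addrK sub0r.
suff E : fps_dissect 25 A = fps_dissect 625 A.
  by have := congr1 (fun f => cf f n) E.
(* Two integrations by parts move T^2 from th^3 onto th. The two copies of th^4 cancel, leaving
   U_5(th^3 th^25) = U_5(th^3) th^5. *)
rewrite U625A dissect_theta3 mulrBl fps_dissectB -exprSr dissect_theta4.
rewrite !parts opprK euler2_theta mulrBr fps_dissectB -exprSr dissect_theta4.
by rewrite opprB addrC subrK U25A (exprM th 5 5) frob.
Qed.
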